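(* Let $\boldsymbol{k}$ be a field and work with $\mathbb N\times\mathbb N$ matrices over $\boldsymbol{k}$. For every $m\in\mathbb N$, $$\big(\oplus(\mathcal{I})-\ominus(\mathcal{I})\big)^{m}=\sum_{r=0}^m\binom{m}{r}(-1)^r\oplus^{m-2r}(\mathcal{I})\;+\;(-1)^m\sum_{l=0}^{\lfloor m/2\rfloor-1}\binom{m}{l}(-1)^l\mathcal{J}^{(a)}_{m-1-2l}.$$
   Context: $\mathcal{I}$ is the $\mathbb N\times\mathbb N$ identity matrix (indices start at 1). For $\mathcal{M}=(m_{i,j})_{i,j\ge1}$, $\oplus(\mathcal{M})$ has $(i,j)$ entry $m_{i-1,j}$ if $i>1$ and $0$ if $i=1$, and $\ominus(\mathcal{M})$ has $(i,j)$ entry $m_{i+1,j}$. For $s\ge0$, $\oplus^s$ and $\ominus^s$ denote $s$-fold iterates ($\oplus^0=\ominus^0=$ identity map), and $\oplus^{-s}:=\ominus^{s}$. Thus $\oplus(\mathcal{I})$ has ones on the subdiagonal and $\ominus(\mathcal{I})$ has ones on the superdiagonal. $\mathcal{J}^{(a)}_l$ is the matrix whose $(i,j)$ entry is $(-1)^{i-1}$ if $i+j=l+1$ and $0$ otherwise. Integer coefficients are interpreted in $\boldsymbol{k}$. *)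

(* Defs.v *)
From HB Require Import structures.
From mathcomp Require Import all_boot all_order all_algebra.
From mathcomp Require Import boolp classical_sets functions cardinality fsbigop.

Set Implicit Arguments.
Unset Strict Implicit.
Unset Printing Implicit Defensive.
Import GRing.Theory.
Local Open Scope classical_set_scope.
Local Open Scope ring_scope.

(* N x N matrices, with rows and columns numbered 1, 2, 3, ... : for
   M : nmx k, the Rocq term [M i j] is the entry in row i.+1, column j.+1.
   Only the module structure of [nat -> nat -> k^o] is transported to [nmx k]:
   its ring structure is pointwise, which is not the product of matrices. *)
Definition nmx (k : fieldType) : Type := nat -> nat -> k^o.

HB.instance Definition _ (k : fieldType) :=
  GRing.Lmodule.copy (nmx k) (nat -> nat -> k^o).

(* The matrix (E i j)_{i, j >= 1}, so that E is written with 1-based indices. *)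
Definition nmx_of (k : fieldType) (E : nat -> nat -> k) : nmx k :=
  fun i j => E i.+1 j.+1.

Definition nmx_id (k : fieldType) : nmx k :=
  nmx_of (fun i j => (i == j)%:R).

(* (A B)_{i,j} = sum_l A_{i,l} B_{l,j}, a sum with finite support as soon as A
   is row-finite or B is column-finite; by the convention on sums over
   [\in setT] the entry is 0 if the support is infinite. *)
Definition nmx_mul (k : fieldType) (A B : nmx k) : nmx k :=
  fun i j => \sum_(l \in [set: nat]) ((A i l : k) * (B l j : k)).

Definition nmx_exp (k : fieldType) (A : nmx k) (n : nat) : nmx k :=
  iter n (nmx_mul A) (nmx_id k).

Definition oplus (k : fieldType) (M : nmx k) : nmx k :=
  fun i j => if i is i'.+1 then M i' j else 0.

Definition ominus (k : fieldType) (M : nmx k) : nmx k :=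
  fun i j => M i.+1 j.

Definition oplus_exp (k : fieldType) (s : int) (M : nmx k) : nmx k :=
  match s with
  | Posz n => iter n (@oplus k) M
  | Negz n => iter n.+1 (@ominus k) M
  end.

Definition nmx_J (k : fieldType) (l : nat) : nmx k :=
  nmx_of (fun i j =>
    if (i + j == l + 1)%N then (-1) ^+ (i - 1) else 0).

(* Main.v *)
(** Multiplying by [oplus I - ominus I] sends the rows [M i] of a matrix to
    [M (i - 1) - M (i + 1)], with the convention [M (- 1) = 0]. Over all integer
    rows this recurrence is solved by signed binomial coefficients, which give
    the first sum; the reflection principle turns the boundary condition at row
    [- 1] into the image term, which is the sum of the [nmx_J]. *)
Require Import Defs.
From HB Require Import structures.
From mathcomp Require Import all_boot all_order all_algebra.
From mathcomp Require Import boolp classical_sets functions cardinality fsbigop.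
From mathcomp Require Import zify ring.

Set Implicit Arguments.
Unset Strict Implicit.
Unset Printing Implicit Defensive.
Import GRing.Theory.
Local Open Scope ring_scope.

Section NatMatrix.
Variable k : fieldType.
Implicit Types (M : nmx k) (m i j : nat) (d : int).

Lemma nmx_addE M N i j : (M + N) i j = M i j + N i j.
Proof. by []. Qed.

Lemma nmx_oppE M i j : (- M) i j = - M i j.
Proof. by []. Qed.

Lemma nmx_scaleE (a : k) M i j : (a *: M) i j = a * M i j.
Proof. by []. Qed.

Lemma nmx_sumE (I : Type) (s : seq I) (F : I -> nmx k) i j :
  (\sum_(x <- s) F x) i j = \sum_(x <- s) F x i j.
Proof. by elim/big_rec2: _ => // x y M _ <-. Qed.

Lemma nmx_idE i j : nmx_id k i j = (i == j)%:R.
Proof. by []. Qed.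

Lemma iter_oplus_idE n i j : iter n (@oplus k) (nmx_id k) i j = (i == j + n)%N%:R.
Proof.
elim: n i => [|n IHn] [|i] /=; rewrite ?nmx_idE ?addn0 ?addnS //.
Qed.

Lemma iter_ominusE n M i j : iter n (@ominus k) M i j = M (i + n)%N j.
Proof. by elim: n i => [|n IHn] i /=; rewrite ?addn0 // /ominus IHn addSnnS. Qed.

Lemma oplus_exp_idE d i j :
  oplus_exp d (nmx_id k) i j = (i%:Z - j%:Z == d)%:R.
Proof.
case: d => n; rewrite /oplus_exp ?iter_oplus_idE ?iter_ominusE ?nmx_idE;
  congr (nat_of_bool _)%:R; lia.
Qed.

Lemma nmx_JE l i j :
  nmx_J k l i j = (-1) ^+ i * (i%:Z + j%:Z + 1 == l%:Z)%:R.
Proof.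
rewrite /nmx_J /nmx_of subn1 /=.
have -> : (i.+1 + j.+1 == l + 1)%N = (i%:Z + j%:Z + 1 == l%:Z) by lia.
by case: eqP; rewrite ?mulr1 ?mulr0.
Qed.

(** Row [i] of the left factor is supported on the columns [i - 1] and [i + 1], or on column [1]
    alone when [i = 0], so the sum defining the product is finite. *)
Lemma nmx_mul_shift_diff M :
  nmx_mul (oplus (nmx_id k) - ominus (nmx_id k)) M = oplus M - ominus M.
Proof.
apply/funext => i; apply/funext => j; rewrite /nmx_mul.
rewrite (fsbigE (if i is i'.+1 then [:: i'; i.+1] else [:: 1%N])) //=.
- under eq_bigl do rewrite in_setT.
  case: i => [|i]; rewrite ?big_cons big_nil !nmx_addE !nmx_oppE /oplus /ominus.
    by rewrite nmx_idE eqxx addr0 !sub0r mulN1r.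
  rewrite !nmx_idE !eqxx.
  have -> : (i == i.+2) = false by lia.
  have -> : (i.+2 == i) = false by lia.
  by rewrite subr0 sub0r mul1r mulN1r addr0.
- by case: i => //= i; rewrite inE; lia.
- move=> l _ li; rewrite nmx_addE nmx_oppE /oplus /ominus !nmx_idE.
  have /negbTE -> : i.+1 != l by case: i li => [|i]; rewrite !inE; lia.
  case: i li => [|i]; rewrite !inE ?subr0 ?mul0r // nmx_idE => li.
  by have /negbTE -> : i != l; [lia | rewrite mul0r].
Qed.

(** The coefficient of [x^d] in the Laurent polynomial [(x - 1/x)^m]. *)
Definition signed_binom m d : k :=
  \sum_(0 <= r < m.+1) 'C(m, r)%:R * (-1) ^+ r * (d == m%:Z - (2 * r)%:Z)%:R.

Lemma signed_binom0 d : signed_binom 0 d = (d == 0)%:R.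
Proof. by rewrite /signed_binom big_nat1 bin0 expr0 !mul1r. Qed.

(** Multiplication by [x - 1/x], which amounts to Pascal's rule. *)
Lemma signed_binomS m d :
  signed_binom m.+1 d = signed_binom m (d - 1) - signed_binom m (d + 1).
Proof.
rewrite /signed_binom big_nat_recl // bin0 -sumrN.
under eq_bigr do rewrite binS natrD !mulrDl.
rewrite big_split /= addrA; congr (_ + _); last first.
  apply: eq_bigr => r _; rewrite exprS mulN1r !(mulrN, mulNr).
  congr (- (_ * (nat_of_bool _)%:R)); lia.
(* The extra last term vanishes since ['C(m, m.+1) = 0]. *)
rewrite [RHS]big_nat_recl // bin0 big_nat_recr //= bin_small // !mul0r.
congr (_ * (nat_of_bool _)%:R + _); first lia.
rewrite addr0; apply: eq_bigr => r _; congr (_ * (nat_of_bool _)%:R); lia.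
Qed.

(** Exchanging [x] and [1/x] negates [x - 1/x]. *)
Lemma signed_binomN m d : signed_binom m (- d) = (-1) ^+ m * signed_binom m d.
Proof.
elim: m d => [|m IHm] d; first by rewrite !signed_binom0 oppr_eq0 mul1r.
rewrite !signed_binomS -opprD IHm [- d + 1](_ : _ = - (d - 1)); last by ring.
by rewrite IHm exprS; ring.
Qed.

(** The source at row [j] has its mirror image across row [-1] at row [-j - 2], at distance
    [i + j + 2] from row [i]. The sign [(-1)^(m + i)] makes the image term obey the same recurrence
    and cancel the direct term at row [-1]. *)
Definition reflected_binom m : nmx k := fun i j =>
  signed_binom m (i%:Z - j%:Z)
  + (-1) ^+ m * ((-1) ^+ i * signed_binom m (i%:Z + j%:Z + 2)).

Lemma reflected_binom0 : reflected_binom 0 = nmx_id k.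
Proof.
apply/funext => i; apply/funext => j.
rewrite /reflected_binom !signed_binom0 nmx_idE.
have -> : (i%:Z + j%:Z + 2 == 0) = false by lia.
by rewrite !mulr0 addr0; congr (nat_of_bool _)%:R; lia.
Qed.

Lemma reflected_binomS m :
  reflected_binom m.+1 = oplus (reflected_binom m) - ominus (reflected_binom m).
Proof.
apply/funext => i; apply/funext => j; rewrite nmx_addE nmx_oppE.
rewrite /oplus /ominus /reflected_binom !signed_binomS.
have -> : i%:Z - j%:Z + 1 = i.+1%:Z - j%:Z by lia.
have -> : i%:Z + j%:Z + 2 + 1 = i.+1%:Z + j%:Z + 2 by lia.
case: i => [|i].
  (* In the top row [oplus] gives 0: the direct and image values at row [-1] must cancel, by the
     parity of [signed_binom]. *)
  have -> : 0%:Z - j%:Z - 1 = - (j%:Z + 1) by lia.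
  have -> : 0%:Z + j%:Z + 2 - 1 = j%:Z + 1 by lia.
  by rewrite signed_binomN !exprS; ring.
have -> : i.+1%:Z - j%:Z - 1 = i%:Z - j%:Z by lia.
have -> : i.+1%:Z + j%:Z + 2 - 1 = i%:Z + j%:Z + 2 by lia.
by rewrite !exprS; ring.
Qed.

Lemma nmx_exp_shift_diff m :
  nmx_exp (oplus (nmx_id k) - ominus (nmx_id k)) m = reflected_binom m.
Proof.
elim: m => [|m IHm]; first by rewrite reflected_binom0.
by rewrite /nmx_exp iterS -/(nmx_exp _ m) IHm nmx_mul_shift_diff reflected_binomS.
Qed.

(** Only indices with [m - 2r >= 2] contribute, that is [r < m./2]; for these the natural
    subtraction [m - 1 - 2 * l] does not truncate. *)
Lemma signed_binom_half m n :
  signed_binom m (n%:Z + 2) =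
  \sum_(0 <= l < m./2)
     'C(m, l)%:R * (-1) ^+ l * (n%:Z + 1 == (m - 1 - 2 * l)%:Z)%:R.
Proof.
rewrite /signed_binom (@big_cat_nat _ _ _ m./2) //=; last by lia.
rewrite [X in _ + X]big_nat [X in _ + X]big1 ?addr0; last first.
  move=> r /andP[mr _].
  by have -> : (n%:Z + 2 == m%:Z - (2 * r)%:Z) = false; [lia | rewrite mulr0].
apply: eq_big_nat => r /andP[_ rm].
by congr (_ * (nat_of_bool _)%:R); lia.
Qed.

End NatMatrix.

Theorem theorem3 (k : fieldType) (m : nat) :
  nmx_exp (oplus (nmx_id k) - ominus (nmx_id k)) m =
    \sum_(0 <= r < m.+1)
       ('C(m, r)%:R * (-1) ^+ r) *: oplus_exp (m%:Z - (2 * r)%:Z) (nmx_id k)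
    + (-1) ^+ m *:
      \sum_(0 <= l < m./2)
         ('C(m, l)%:R * (-1) ^+ l) *: nmx_J k (m - 1 - 2 * l).
Proof.
rewrite nmx_exp_shift_diff; apply/funext => i; apply/funext => j.
rewrite nmx_addE nmx_scaleE !nmx_sumE /reflected_binom.
congr (_ + _ * _).
  by apply: eq_bigr => r _; rewrite nmx_scaleE oplus_exp_idE.
(* The image term is evaluated at [i + j + 2 >= 2], so the half sum applies with [n = i + j]. *)
rewrite -PoszD signed_binom_half mulr_sumr.
by apply: eq_bigr => l _; rewrite nmx_scaleE nmx_JE PoszD mulrCA.
Qed.
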